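(* Let $a,b,c,d$ be positive reals and let $H$ be a C-function. Let $\varepsilon>0$ be a real number compatible with $c,d$, such that $H(x)>0$ and $H''(x)\le 0$ for all $x\in[0,\varepsilon]$. Then the limit $$\lim_{n\to\infty}D_n(a,b,c,d,\varepsilon;H)=\lim_{n\to\infty}\prod_{j=0}^{m(n)}\frac{H\left((cj+a)\frac{d}{n}\right)}{H\left((cj+b)\frac{d}{n}\right)}$$ exists and is positive.
   Context: A C-function is a nonconstant real function $H$, analytic around $0$, such that $H(0)>0$, $H'(0)=0$, and $H''(x)\le 0$ for all positive $x$ sufficiently close to $0$. The function $H$ is understood to be defined and twice differentiable on $[0,\varepsilon]$. Compatibility of $\varepsilon$ with $c,d$ means: $\varepsilon\le cd$, and if $\varepsilon=cd$ then $cd>1$. For $n\in\mathbb{N}$, $m=m(n)\in\mathbb{N}$ is the maximum integer such that both $(cm+a)\frac dn\le\varepsilon$ and $(cm+b)\frac dn\le\varepsilon$, that is, $m(n)=\left\lfloor \frac{n\varepsilon}{cd}-\frac{\max(a,b)}{c}\right\rfloor$ (this is a nonnegative integer for all sufficiently large $n$). The parameters $a,b,c,d,\varepsilon$ are fixed while $n\to\infty$. *)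

(* Defs.v *)
From Stdlib Require Import Reals ZArith Lra Lia.
From Coquelicot Require Import Coquelicot.
Local Open Scope R_scope.

(** A partial real function is a total [H : R -> R] together with its domain
    [D]; values outside [D] are irrelevant. *)

Definition analytic_at_0 (D : R -> Prop) (H : R -> R) : Prop :=
  exists (u : nat -> R) (r : R), 0 < r /\
    forall x, Rabs x < r -> D x /\ is_pseries u x (H x).

(** [Derive] and [Derive_n] are meaningful here: analyticity makes [H] smooth
    near 0. *)
Definition C_function (D : R -> Prop) (H : R -> R) : Prop :=
  (exists x y, D x /\ D y /\ H x <> H y) /\
  analytic_at_0 D H /\
  0 < H 0 /\
  Derive H 0 = 0 /\
  at_right 0 (fun x => Derive_n H 2 x <= 0).

Definition segment0 (eps x : R) : Prop := 0 <= x <= eps.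

(** Derivatives are taken relative to [I], hence one-sided at the endpoints
    when [I] is a segment. *)
Definition is_second_derivative_on (I : R -> Prop) (H H2 : R -> R) : Prop :=
  exists H1 : R -> R, forall x, I x -> D_in H H1 I x /\ D_in H1 H2 I x.

Definition compatible (eps c d : R) : Prop :=
  eps <= c * d /\ (eps = c * d -> 1 < c * d).

Definition mZ (a b c d eps : R) (n : nat) : Z :=
  Zfloor (INR n * eps / (c * d) - Rmax a b / c).

Lemma mZ_max (a b c d eps : R) (n : nat) (k : Z) :
  0 < c -> 0 < d -> (0 < n)%nat ->
  ((c * IZR k + a) * (d / INR n) <= eps /\ (c * IZR k + b) * (d / INR n) <= eps)
  <-> (k <= mZ a b c d eps n)%Z.
Proof.
intros Hc Hd Hn.
assert (HN : 0 < INR n) by (apply lt_0_INR; lia).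
assert (E : forall t, (c * IZR k + t) * (d / INR n) <= eps <->
              IZR k <= INR n * eps / (c * d) - t / c).
{ intro t.
  assert (Hp : 0 < c * d / INR n)
    by (apply Rdiv_lt_0_compat; [apply Rmult_lt_0_compat|]; assumption).
  assert (E1 : (c * IZR k + t) * (d / INR n) - eps =
     c * d / INR n * (IZR k - (INR n * eps / (c * d) - t / c)))
    by (field; lra).
  split; intro L; nra. }
assert (F : (k <= mZ a b c d eps n)%Z <->
            IZR k <= INR n * eps / (c * d) - Rmax a b / c).
{ unfold mZ; split; intro L.
  - apply IZR_le in L.
    pose proof (Zfloor_bound (INR n * eps / (c * d) - Rmax a b / c)); lra.
  - now apply Zfloor_lub. }
rewrite F, !E.
assert (Hm : forall s t, s <= t -> s / c <= t / c).
{ intros s t L; apply Rmult_le_compat_r;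
    [left; now apply Rinv_0_lt_compat | exact L]. }
pose proof (Hm _ _ (Rmax_l a b)); pose proof (Hm _ _ (Rmax_r a b)).
split; [intros [La Lb] | intro L; split; lra].
now apply Rmax_case.
Qed.

(** [mZ] is negative for only finitely many [n], so the truncation of
    [Z.to_nat] does not affect limits. *)
Definition m (a b c d eps : R) (n : nat) : nat :=
  Z.to_nat (mZ a b c d eps n).

(** [prod_f_R0 f N] is the product of [f j] over [0 <= j <= N]. *)
Definition Dprod (a b c d eps : R) (H : R -> R) (n : nat) : R :=
  prod_f_R0 (fun j => H ((c * INR j + a) * (d / INR n)) /
                      H ((c * INR j + b) * (d / INR n)))
            (m a b c d eps n).

(* Main.v *)
(** Put [f = ln H] and [h = d / n].  By the mean value theorem
    [f (x + a h) - f (x + b h)] and [(a - b) / c * (f (x + c h) - f x)] are both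
    [(a - b) h] times a value of [f'] close to [x].  Since [f'] is uniformly
    continuous on [[0, eps]], the logarithm of the product is, up to [o(1)], a
    telescoping sum that tends to [(a - b) / c * (f eps - f 0)].  Hence the limit
    is [(H eps / H 0) ^ ((a - b) / c)]. *)
Require Import Defs.
From Stdlib Require Import Reals ZArith Lra Lia.
From Coquelicot Require Import Coquelicot.
Local Open Scope R_scope.

(** * Extending functions from a segment to the line *)

(** Nearest-point projection onto [0, e]. Composing with it turns regularity relative to the
    segment, one-sided at the endpoints, into continuity on the whole line, the form in which the
    mean value theorem and Heine's theorem are applied below. *)
Definition clamp (e x : R) : R := Rmax 0 (Rmin x e).

Lemma clamp_segment (e x : R) : 0 <= e -> segment0 e (clamp e x).
Proof.
intro He; unfold segment0, clamp, Rmax, Rmin.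
repeat destruct Rle_dec; lra.
Qed.

Lemma clamp_id (e x : R) : segment0 e x -> clamp e x = x.
Proof.
unfold segment0, clamp, Rmax, Rmin; intro Hx.
repeat destruct Rle_dec; lra.
Qed.

Lemma clamp_contract (e x y : R) :
  Rabs (clamp e x - clamp e y) <= Rabs (x - y).
Proof.
unfold clamp, Rmax, Rmin, Rabs.
repeat destruct Rle_dec; repeat destruct Rcase_abs; lra.
Qed.

Lemma continuity_pt_clamp (e : R) (F : R -> R) (x : R) :
  0 <= e -> (forall y, segment0 e y -> continue_in F (segment0 e) y) ->
  continuity_pt (fun t => F (clamp e t)) x.
Proof.
intros He HF r Hr.
destruct (HF (clamp e x) (clamp_segment e x He) r Hr) as [alp [Ha HA]].
exists alp; split; [exact Ha|]; intros t [_ Ht].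
simpl in *; unfold Rdist in *.
(* [continue_in] is a punctured limit, so it says nothing when the two projections coincide, which
   happens for distinct points on the same side of the segment. *)
destruct (Req_dec (clamp e t) (clamp e x)) as [E|N].
- rewrite E, Rminus_diag, Rabs_R0; lra.
- apply HA; split.
  + split; [now apply clamp_segment | congruence].
  + pose proof (clamp_contract e t x); lra.
Qed.

Lemma is_derive_clamp (e : R) (F F' : R -> R) (x : R) :
  0 < x < e -> D_in F F' (segment0 e) x ->
  is_derive (fun t => F (clamp e t)) x (F' x).
Proof.
intros Hx HD; apply is_derive_Reals; intros r Hr.
destruct (HD r Hr) as [alp [Ha HA]].
(* Increments below x and e - x stay inside the segment, where [clamp] is the identity. *)
assert (Hp : 0 < Rmin alp (Rmin x (e - x)))
  by (repeat apply Rmin_pos; lra).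
exists (mkposreal _ Hp); simpl; intros k Hk Hkl.
assert (Hk1 : Rabs k < alp) by (eapply Rlt_le_trans; [exact Hkl | apply Rmin_l]).
assert (Hk2 : Rabs k < x /\ Rabs k < e - x).
{ pose proof (Rmin_r alp (Rmin x (e - x))).
  pose proof (Rmin_l x (e - x)); pose proof (Rmin_r x (e - x)); lra. }
assert (Hk3 : - Rabs k <= k <= Rabs k)
  by (unfold Rabs; destruct Rcase_abs; lra).
assert (Hxk : segment0 e (x + k)) by (unfold segment0; lra).
rewrite (clamp_id e (x + k)), (clamp_id e x) by (unfold segment0 in *; lra).
specialize (HA (x + k)); simpl in HA; unfold Rdist in HA.
replace (x + k - x) with k in HA by ring.
apply HA; repeat split; unfold segment0 in *; lra.
Qed.

(** * Mean value estimates and telescoping *)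

Lemma segment_mvt (e : R) (f g : R -> R) (u v : R) :
  (forall x, continuity_pt f x) ->
  (forall x, 0 < x < e -> is_derive f x (g x)) ->
  segment0 e u -> segment0 e v ->
  exists w, Rmin u v <= w <= Rmax u v /\ f v - f u = g w * (v - u).
Proof.
intros Hc Hd Hu Hv; unfold segment0 in *.
apply MVT_gen; [|auto].
intros x Hx; apply Hd; revert Hx.
unfold Rmin, Rmax; destruct Rle_dec; lra.
Qed.

(** The left side equals (a - b) h (g y - g z) with y between x + b h and x + a h, and z between x
    and x + c h. The crude distance (a + b + c) h covers every ordering of a, b and c. *)
Lemma mvt_step (e : R) (f g : R -> R) (a b c x h w : R) :
  0 < a -> 0 < b -> 0 < c -> 0 < h -> 0 <= x ->
  (forall x, continuity_pt f x) ->
  (forall x, 0 < x < e -> is_derive f x (g x)) ->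
  (forall y z, segment0 e y -> segment0 e z ->
     Rabs (y - z) <= (a + b + c) * h -> Rabs (g y - g z) <= w) ->
  x + a * h <= e -> x + b * h <= e -> x + c * h <= e ->
  Rabs (f (x + a * h) - f (x + b * h) - (a - b) / c * (f (x + c * h) - f x))
    <= Rabs (a - b) * h * w.
Proof.
intros Ha Hb Hc Hh Hx Hf Hd Hg La Lb Lc.
assert (0 < a * h) by now apply Rmult_lt_0_compat.
assert (0 < b * h) by now apply Rmult_lt_0_compat.
assert (0 < c * h) by now apply Rmult_lt_0_compat.
destruct (segment_mvt e f g (x + b * h) (x + a * h) Hf Hd) as [y [Hy Ey]];
  [unfold segment0; lra..|].
destruct (segment_mvt e f g x (x + c * h) Hf Hd) as [z [Hz Ez]];
  [unfold segment0; lra..|].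
rewrite Ey, Ez.
replace (g y * (x + a * h - (x + b * h)) - (a - b) / c * (g z * (x + c * h - x)))
  with ((a - b) * h * (g y - g z)) by (field; lra).
rewrite !Rabs_mult, (Rabs_pos_eq h) by lra.
apply Rmult_le_compat_l.
{ apply Rmult_le_pos; [apply Rabs_pos | lra]. }
revert Hy Hz; unfold Rmin, Rmax; repeat destruct Rle_dec; intros Hy Hz;
  apply Hg; unfold segment0; try apply Rabs_le; lra.
Qed.

(** The last term [T M] is set aside: comparing it with a telescoping increment would require c (M +
    1) h <= e, which the hypotheses do not provide. For each j < M this bound follows from the one
    on the next index, so [mvt_step] applies. *)
Lemma telescoping_bound (e : R) (f g : R -> R) (a b c h w : R) (M : nat) :
  0 < a -> 0 < b -> 0 < c -> 0 < h ->
  (forall x, continuity_pt f x) ->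
  (forall x, 0 < x < e -> is_derive f x (g x)) ->
  (forall y z, segment0 e y -> segment0 e z ->
     Rabs (y - z) <= (a + b + c) * h -> Rabs (g y - g z) <= w) ->
  (c * INR M + a) * h <= e -> (c * INR M + b) * h <= e ->
  let T j := f ((c * INR j + a) * h) - f ((c * INR j + b) * h) in
  Rabs (sum_f_R0 T M - T M - (a - b) / c * (f (c * INR M * h) - f 0))
    <= INR M * (Rabs (a - b) * h * w).
Proof.
intros Ha Hb Hc Hh Hf Hd Hg; induction M as [|M IH]; intros La Lb T.
- simpl. replace (c * 0 * h) with 0 by ring.
  rewrite !Rminus_diag, Rmult_0_r, Rmult_0_l, Rminus_0_r, Rabs_R0; lra.
- rewrite S_INR in La, Lb.
  assert (0 < a * h) by now apply Rmult_lt_0_compat.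
  assert (0 < b * h) by now apply Rmult_lt_0_compat.
  assert (0 < c * h) by now apply Rmult_lt_0_compat.
  assert (0 <= c * INR M * h)
    by (apply Rmult_le_pos; [apply Rmult_le_pos; [lra | apply pos_INR] | lra]).
  specialize (IH ltac:(lra) ltac:(lra)); cbv zeta in IH; fold T in IH.
  pose proof (mvt_step e f g a b c (c * INR M * h) h w Ha Hb Hc Hh
    ltac:(lra) Hf Hd Hg ltac:(lra) ltac:(lra) ltac:(lra)) as St.
  rewrite S_INR.
  replace (c * (INR M + 1) * h) with (c * INR M * h + c * h) by ring.
  replace (f (c * INR M * h + a * h) - f (c * INR M * h + b * h)) with (T M) in St
    by (unfold T; f_equal; f_equal; ring).
  replace (sum_f_R0 T (S M) - T (S M) -
     (a - b) / c * (f (c * INR M * h + c * h) - f 0)) with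
   ((sum_f_R0 T M - T M - (a - b) / c * (f (c * INR M * h) - f 0)) +
    (T M - (a - b) / c * (f (c * INR M * h + c * h) - f (c * INR M * h))))
   by (simpl; ring).
  eapply Rle_trans; [apply Rabs_triang|]; lra.
Qed.

(** * The upper index for large n *)

Lemma eventually_INR_gt (K : R) : eventually (fun n => K < INR n).
Proof.
apply (proj2 (is_lim_seq_spec INR p_infty) is_lim_seq_INR).
Qed.

Lemma m_bounds (a b c d e : R) :
  0 < c -> 0 < d -> 0 < e ->
  eventually (fun n => let h := d / INR n in let M := INR (m a b c d e n) in
    (c * M + a) * h <= e /\ (c * M + b) * h <= e /\
    e < (c * (M + 1) + Rmax a b) * h).
Proof.
intros Hc Hd He.
(* Beyond this threshold n e > max(a, b) d, so the floor in [mZ] is nonnegative and [Z.to_nat] loses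
   nothing; the 0 guarantees n > 0. *)
destruct (eventually_INR_gt (Rmax 0 (Rmax a b * d / e))) as [N HN].
exists N; intros n Hn h M; specialize (HN n Hn).
assert (Hn0 : 0 < INR n) by (pose proof (Rmax_l 0 (Rmax a b * d / e)); lra).
assert (Hn1 : Rmax a b * d / e < INR n)
  by (pose proof (Rmax_r 0 (Rmax a b * d / e)); lra).
apply (Rmult_lt_compat_r e) in Hn1; [|exact He].
replace (Rmax a b * d / e * e) with (Rmax a b * d) in Hn1 by (field; lra).
assert (HcD : 0 < / (c * d)) by (apply Rinv_0_lt_compat, Rmult_lt_0_compat; lra).
assert (Hz : (0 <= mZ a b c d e n)%Z).
{ apply Zfloor_lub; simpl.
  replace (INR n * e / (c * d) - Rmax a b / c)
    with ((INR n * e - Rmax a b * d) * / (c * d)) by (field; lra).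
  apply Rmult_le_pos; lra. }
assert (HM : M = IZR (mZ a b c d e n)).
{ unfold M, m; rewrite INR_IZR_INZ, Z2Nat.id; auto. }
assert (Hnn : (0 < n)%nat) by now apply INR_lt.
destruct (proj2 (mZ_max a b c d e n (mZ a b c d e n) Hc Hd Hnn) (Z.le_refl _))
  as [La Lb].
rewrite <- HM in La, Lb; repeat split; [exact La | exact Lb |].
(* Otherwise [mZ] + 1 would satisfy both inequalities, contradicting maximality. *)
apply Rnot_le_lt; intro L.
assert (Hh : 0 < h) by now apply Rdiv_lt_0_compat.
assert (Hs : (mZ a b c d e n + 1 <= mZ a b c d e n)%Z); [|lia].
apply mZ_max; auto; rewrite plus_IZR, <- HM; fold h.
pose proof (Rmax_l a b); pose proof (Rmax_r a b).
split; eapply Rle_trans; [|exact L| |exact L];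
  apply Rmult_le_compat_r; lra.
Qed.

(** * Convergence of the logarithmic sum *)

Lemma sum_limit (e : R) (f g : R -> R) (a b c d : R) :
  0 < a -> 0 < b -> 0 < c -> 0 < d -> 0 < e ->
  (forall x, continuity_pt f x) -> (forall x, continuity_pt g x) ->
  (forall x, 0 < x < e -> is_derive f x (g x)) ->
  is_lim_seq (fun n => sum_f_R0
      (fun j => f ((c * INR j + a) * (d / INR n)) - f ((c * INR j + b) * (d / INR n)))
      (m a b c d e n))
    (Finite ((a - b) / c * (f e - f 0))).
Proof.
intros Ha Hb Hc Hd He Hf Hg Hder.
apply is_lim_seq_spec; intros r.
set (A := Rabs (a - b)).
assert (HA : 0 <= A) by apply Rabs_pos.
(* K w bounds the total error: A (e / c) w from telescoping, (A / c) w from replacing f (c M h) by f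
   e, and w from the last term [T M]. *)
set (K := A * (e / c) + A / c + 1).
assert (HAc : 0 <= A / c) by (apply Rdiv_le_0_compat; lra).
assert (Hec : 0 < e / c) by (apply Rdiv_lt_0_compat; lra).
assert (HAe : 0 <= A * (e / c)) by (apply Rmult_le_pos; lra).
assert (HK : 0 < K) by (unfold K; lra).
assert (Hw : 0 < r / (2 * K))
  by (apply Rdiv_lt_0_compat; [apply cond_pos | lra]).
set (w := mkposreal _ Hw).
assert (HwK : w * K < r).
{ simpl; replace (r / (2 * K) * K) with (r / 2) by (field; lra).
  pose proof (cond_pos r); lra. }
assert (Hw0 : 0 < w) by exact Hw.
destruct (Heine f (segment0 e) (compact_P3 0 e) (fun x _ => Hf x) w) as [d1 U1].
destruct (Heine g (segment0 e) (compact_P3 0 e) (fun x _ => Hg x) w) as [d2 U2].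
pose proof (cond_pos d1); pose proof (cond_pos d2).
assert (Hdl : 0 < Rmin d1 d2) by (apply Rmin_pos; lra).
(* For such n, (a + b + c) h is below the uniform continuity moduli of both f and g. *)
assert (E1 := eventually_INR_gt (Rmax 0 ((a + b + c) * d / Rmin d1 d2))).
generalize (filter_and _ _ E1 (m_bounds a b c d e Hc Hd He)).
apply filter_imp; clear E1; intros n [Hn [La [Lb Lm]]].
set (h := d / INR n) in *; set (M := m a b c d e n) in *.
assert (Hn0 : 0 < INR n)
  by (pose proof (Rmax_l 0 ((a + b + c) * d / Rmin d1 d2)); lra).
assert (Hn1 : (a + b + c) * d / Rmin d1 d2 < INR n)
  by (pose proof (Rmax_r 0 ((a + b + c) * d / Rmin d1 d2)); lra).
assert (Hh : 0 < h) by now apply Rdiv_lt_0_compat.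
assert (Hsmall : (a + b + c) * h < Rmin d1 d2).
{ apply (Rmult_lt_compat_r (Rmin d1 d2 / INR n)) in Hn1;
    [|now apply Rdiv_lt_0_compat].
  unfold h.
  replace ((a + b + c) * d / Rmin d1 d2 * (Rmin d1 d2 / INR n))
    with ((a + b + c) * (d / INR n)) in Hn1 by (field; lra).
  replace (INR n * (Rmin d1 d2 / INR n)) with (Rmin d1 d2) in Hn1 by (field; lra).
  exact Hn1. }
pose proof (Rmin_l d1 d2); pose proof (Rmin_r d1 d2).
assert (Hg' : forall y z, segment0 e y -> segment0 e z ->
     Rabs (y - z) <= (a + b + c) * h -> Rabs (g y - g z) <= w).
{ intros y z Hy Hz Hyz; left; apply U2; auto; lra. }
pose proof (telescoping_bound e f g a b c h w M Ha Hb Hc Hh Hf Hder Hg' La Lb) as TB.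
cbv zeta in TB.
set (T := fun j : nat => f ((c * INR j + a) * h) - f ((c * INR j + b) * h)) in *.
change (f ((c * INR M + a) * h) - f ((c * INR M + b) * h)) with (T M) in TB.
assert (0 < a * h) by now apply Rmult_lt_0_compat.
assert (0 < b * h) by now apply Rmult_lt_0_compat.
assert (0 < c * h) by now apply Rmult_lt_0_compat.
assert (Hx0 : 0 <= c * INR M * h)
  by (apply Rmult_le_pos; [apply Rmult_le_pos; [lra | apply pos_INR] | lra]).
(* Together with [Lm] this puts e within (a + b + c) h of c M h. *)
assert (Hmax : (c * (INR M + 1) + Rmax a b) * h <= c * INR M * h + (a + b + c) * h).
{ replace (c * INR M * h + (a + b + c) * h)
    with ((c * (INR M + 1) + (a + b)) * h) by ring.
  apply Rmult_le_compat_r; [lra|].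
  assert (Rmax a b <= a + b) by (apply Rmax_lub; lra); lra. }
assert (BT : Rabs (T M) < w).
{ apply U1; unfold segment0; try lra.
  apply Rabs_lt_between; lra. }
assert (Be : Rabs (f (c * INR M * h) - f e) < w).
{ apply U1; unfold segment0; try lra.
  apply Rabs_lt_between; lra. }
(* There are M errors of size A h w, and M h <= e / c because c M h <= e, so their sum is bounded
   independently of n. *)
assert (BM : INR M * (Rabs (a - b) * h * w) <= A * (e / c) * w).
{ fold A; replace (INR M * (A * h * w)) with (A * w * (c * INR M * h / c))
    by (field; lra).
  replace (A * (e / c) * w) with (A * w * (e / c)) by ring.
  apply Rmult_le_compat_l; [apply Rmult_le_pos; lra|].
  apply Rmult_le_compat_r; [left; now apply Rinv_0_lt_compat | lra]. }
assert (BE : Rabs ((a - b) / c * (f (c * INR M * h) - f e)) <= A / c * w).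
{ unfold Rdiv; rewrite !Rabs_mult, (Rabs_pos_eq (/ c));
    [|left; now apply Rinv_0_lt_compat].
  apply Rmult_le_compat_l; [exact HAc | lra]. }
replace (sum_f_R0 T M - (a - b) / c * (f e - f 0)) with
  ((sum_f_R0 T M - T M - (a - b) / c * (f (c * INR M * h) - f 0)) + T M
    + (a - b) / c * (f (c * INR M * h) - f e)) by ring.
eapply Rle_lt_trans; [apply Rabs_triang|].
eapply Rle_lt_trans; [apply Rplus_le_compat_r, Rabs_triang|].
eapply Rle_lt_trans; [|exact HwK]; unfold K; lra.
Qed.

(** * Passage from sums to products *)

Lemma exp_sum_f_R0 (u v : nat -> R) (M : nat) :
  (forall j, (j <= M)%nat -> v j = exp (u j)) ->
  exp (sum_f_R0 u M) = prod_f_R0 v M.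
Proof.
induction M as [|M IH]; intro E; simpl.
- symmetry; apply E; lia.
- rewrite exp_plus, IH, (E (S M)); auto.
Qed.

Theorem theorem5 (a b c d : R)
  (ha : 0 < a) (hb : 0 < b) (hc : 0 < c) (hd : 0 < d)
  (D : R -> Prop) (H : R -> R) (hH : C_function D H)
  (eps : R) (heps : 0 < eps) (hcomp : compatible eps c d)
  (hD : forall x, segment0 eps x -> D x)
  (H2 : R -> R) (hH2 : is_second_derivative_on (segment0 eps) H H2)
  (hpos : forall x, segment0 eps x -> 0 < H x /\ H2 x <= 0) :
  exists l : R, is_lim_seq (Dprod a b c d eps H) (Finite l) /\ 0 < l.
Proof.
destruct hH2 as [H1 HD].
assert (He : 0 <= eps) by lra.
assert (Hp : forall x, 0 < H (clamp eps x))
  by (intro x; apply hpos; now apply clamp_segment).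
assert (cH : forall x, continuity_pt (fun t => H (clamp eps t)) x).
{ intro x; apply continuity_pt_clamp; auto.
  intros y Hy; eapply cont_deriv, HD, Hy. }
assert (cH1 : forall x, continuity_pt (fun t => H1 (clamp eps t)) x).
{ intro x; apply continuity_pt_clamp; auto.
  intros y Hy; eapply cont_deriv, HD, Hy. }
(* f is the logarithm of the extended H, and g, on the segment, its logarithmic derivative. *)
set (f := fun t => ln (H (clamp eps t))).
set (g := fun t => H1 (clamp eps t) / H (clamp eps t)).
assert (Hf : forall x, continuity_pt f x).
{ intro x; apply (continuity_pt_comp (fun t => H (clamp eps t)) ln); auto.
  apply derivable_continuous_pt; exists (/ H (clamp eps x)).
  now apply derivable_pt_lim_ln. }
assert (Hg : forall x, continuity_pt g x).
{ intro x; apply (continuity_pt_div _ (fun t => H (clamp eps t))); auto.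
  apply Rgt_not_eq, Hp. }
assert (Hd : forall x, 0 < x < eps -> is_derive f x (g x)).
{ intros x Hx.
  assert (Sx : segment0 eps x) by (unfold segment0; lra).
  (* Only the numerator is unclamped: [is_derive_clamp] yields [H1 x], while [ln] is differentiated
     at the clamped value of H. *)
  unfold g; rewrite (clamp_id eps x Sx) at 1.
  apply (is_derive_comp ln (fun t => H (clamp eps t)) x).
  - now apply is_derive_ln.
  - apply is_derive_clamp; [exact Hx | now apply HD]. }
exists (exp ((a - b) / c * (f eps - f 0))); split; [|apply exp_pos].
eapply is_lim_seq_ext_loc;
  [| apply (is_lim_seq_continuous exp);
     [ apply derivable_continuous_pt, derivable_pt_exp
     | exact (sum_limit eps f g a b c d ha hb hc hd heps Hf Hg Hd) ]].
(* The product is the exponential of the sum only for large n, when all arguments lie in the segment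
   and clamping has no effect. *)
generalize (filter_and _ _ (eventually_INR_gt 0) (m_bounds a b c d eps hc hd heps)).
apply filter_imp; intros n [Hn [La [Lb _]]].
unfold Dprod; apply exp_sum_f_R0; intros j Hj.
assert (Hh : 0 < d / INR n) by now apply Rdiv_lt_0_compat.
(* The arguments increase with j, so the bound at the last index suffices. *)
assert (S : forall t, 0 < t ->
   (c * INR (m a b c d eps n) + t) * (d / INR n) <= eps ->
   segment0 eps ((c * INR j + t) * (d / INR n))).
{ intros t Ht L.
  assert (0 <= c * INR j) by (apply Rmult_le_pos; [lra | apply pos_INR]).
  assert (c * INR j <= c * INR (m a b c d eps n))
    by (apply Rmult_le_compat_l; [lra | now apply le_INR]).
  split; [apply Rmult_le_pos; lra|].
  eapply Rle_trans; [|exact L]; apply Rmult_le_compat_r; lra. }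
unfold f; rewrite !clamp_id by auto.
rewrite <- ln_div, exp_ln; auto; try now apply hpos, S.
apply Rdiv_lt_0_compat; now apply hpos, S.
Qed.
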